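(* Let $k\geq 2$ be an integer and let $P$ be a finite poset of width $w$ that does not contain $\mathbf{k}+\mathbf{k}$ as an induced subposet. Then every First-Fit chain partition of $P$ consists of at most $8(2k-3)w$ chains; that is, First-Fit partitions $P$ into at most $8(2k-3)w$ chains.
   Context: The width of a poset is the maximum size of an antichain. $\mathbf{k}+\mathbf{k}$ denotes the poset consisting of two disjoint chains $A,B$ with $|A|=|B|=k$ in which every element of $A$ is incomparable with every element of $B$. The First-Fit algorithm receives the elements of $P$ one at a time in some order and puts each new element $v$ into the first chain of the current chain partition all of whose elements are comparable to $v$, opening a new chain at the end if there is none. Equivalently, a First-Fit chain partition of $P$ is a sequence $C_1,\dots,C_q$ of nonempty disjoint chains covering $P$ such that for all $1\leq i<j\leq q$ and every $v\in C_j$ there is $u\in C_i$ incomparable to $v$; the chain partitions produced by First-Fit (over all input orders) are exactly the First-Fit chain partitions. *)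

(* Defs.v *)
From mathcomp Require Import all_boot all_order.
Set Implicit Arguments. Unset Strict Implicit. Unset Printing Implicit Defensive.
Import Order.Theory.
Local Open Scope order_scope.

Definition is_chain d (T : finPOrderType d) (C : {set T}) : bool :=
  [forall x in C, forall y in C, x >=< y].

Definition is_antichain d (T : finPOrderType d) (A : {set T}) : bool :=
  [forall x in A, forall y in A, (x != y) ==> ~~ (x >=< y)].

Definition width d (T : finPOrderType d) : nat :=
  (\max_(A : {set T} | is_antichain A) #|A|)%N.

Definition contains_kk d (T : finPOrderType d) (k : nat) : Prop :=
  exists A B : {set T},
    [/\ #|A| = k /\ #|B| = k, is_chain A, is_chain B,
        [disjoint A & B] &
        forall a b, a \in A -> b \in B -> ~~ (a >=< b)].

Definition first_fit_partition d (T : finPOrderType d) (s : seq {set T}) : Prop :=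
  [/\ forall C, C \in s -> C != set0,
      forall C, C \in s -> is_chain C,
      forall i j, (i < j < size s)%N -> [disjoint nth set0 s i & nth set0 s j],
      (forall x : T, exists2 C, C \in s & x \in C) &
      (forall i j, (i < j < size s)%N -> forall v, v \in nth set0 s j ->
        exists2 u, u \in nth set0 s i & ~~ (u >=< v))].

(* Main.v *)
(* Write [k = m.+2] and let [mu b] be the number of elements below [b]. If
   [m.+1] steps lead up from [x] to [b'], [m] steps lead up from [b] to [y], and
   [mu b' <= mu b], then [x < y]: if not, an [a < b] with [~ a < b'] would give
   two incomparable chains of size [k], so everything below [b] is below [b'];
   as [x] is below [b'] but not below [b], this gives [mu b < mu b']. Hence
   "[mu b' <= mu b] for some such [b], [b']" defines an interval order contained
   in the given one. A chain of size
   [2 * k - 2] has its ends separated in it, so by Mirsky's theorem at most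
   [(2 * k - 3) * width] of the intervals share a point.

   It remains to show that First-Fit uses at most [8 * w] colours on a spanning
   subgraph of an interval graph with at most [w] intervals over each point
   (column construction). Start with all points alive and treat the colours in
   order; at each step keep a live point if it is dense, or if the next live
   point to its left or right is covered by the current colour. Here dense means
   that on some final stretch of steps the point was covered at least a quarter
   of the time. Every interval of a later colour still contains a live point,
   so some point survives all colours. For a point among the last to die, the
   dense steps are at most four times its covered steps, and the steps for which
   it is kept by a left neighbour make up at most a quarter of its life, as do
   those on the right; so its life is at most eight times the number of colours
   covering it. *)
Require Import Defs.
From mathcomp Require Import all_boot all_order.
From mathcomp Require Import zify.
Import Order.Theory.
Set Implicit Arguments. Unset Strict Implicit. Unset Printing Implicit Defensive.
Local Open Scope order_scope.

(** * Column construction for First-Fit on intervals *)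

Section FirstFitInterval.
Local Open Scope nat_scope.

Variables (V : finType) (N : nat) (bag : 'I_N -> {set V}) (s : seq {set V}).

Definition covered (h : nat) (p : 'I_N) : bool := nth set0 s h :&: bag p != set0.

Definition hits (p : 'I_N) (n : nat) : nat := \sum_(j < n) covered j p.

Definition adjacent (r : rel 'I_N) (S : {set 'I_N}) (p p' : 'I_N) : bool :=
  [&& p' \in S, r p' p & [forall z in S, r z p ==> ((z == p') || r z p')]].

Definition next_to_covered (r : rel 'I_N) (S : {set 'I_N}) (h : nat) (p : 'I_N) : bool :=
  [exists p', adjacent r S p p' && covered h p'].

Definition dense (p : 'I_N) (n : nat) : bool :=
  [exists g : 'I_n, n - g <= 4 * (hits p n - hits p g)].

Definition ltp : rel 'I_N := fun p q => p < q.
Definition gtp : rel 'I_N := fun p q => q < p.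

Fixpoint alive (n : nat) : {set 'I_N} :=
  if n is h.+1 then
    [set p in alive h | [|| dense p h.+1, next_to_covered ltp (alive h) h p
                          | next_to_covered gtp (alive h) h p]]
  else setT.

Lemma hitsS p n : hits p n.+1 = hits p n + covered n p.
Proof. by rewrite /hits big_ord_recr. Qed.

Lemma leq_hits p m n : m <= n -> hits p m <= hits p n.
Proof.
move=> /subnK <-; elim: (n - m) => // i IH.
by rewrite addSn hitsS (leq_trans IH) ?leq_addr.
Qed.

Lemma alive_sub m n : m <= n -> alive n \subset alive m.
Proof.
move=> /subnK <-; elim: (n - m) => // i IH.
by rewrite addSn /=; apply: subset_trans IH; apply/subsetP=> p; rewrite inE => /andP[].
Qed.

(** Charge from the end: if [dense p n], the window from [g] on has at most four times as many steps
    as hits, and the induction goes on below [g]. *)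
Lemma sum_dense p n : \sum_(j < n) dense p j.+1 <= 4 * hits p n.
Proof.
elim/ltn_ind: n => -[|n] IH; first by rewrite big_ord0.
case: (boolP (dense p n.+1)) => [/existsP[g hg]|hd].
  have gn := ltn_ord g.
  have split_sum : \sum_(j < n.+1) dense p j.+1 <= \sum_(j < g) dense p j.+1 + (n.+1 - g).
    rewrite -!(big_mkord predT (fun j => dense p j.+1 : nat)).
    rewrite (@big_cat_nat _ _ _ g) //=; last exact: ltnW.
    rewrite leq_add2l -[leqRHS]muln1 -sum_nat_const_nat.
    by apply: leq_sum => i _; case: (dense _ _).
  have := IH _ gn; have := @leq_hits p g n.+1 (ltnW gn); lia.
rewrite big_ord_recr /= (negbTE hd) addn0; apply: leq_trans (IH n _) _ => //.
by rewrite leq_mul2l leq_hits.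
Qed.

Lemma adjacent_inj (r : rel 'I_N) (S : {set 'I_N}) p p1 p2 :
  (forall x y, r x y -> ~~ r y x) ->
  adjacent r S p p1 -> adjacent r S p p2 -> p1 = p2.
Proof.
move=> asym /and3P[S1 r1 /forall_inP h1] /and3P[S2 r2 /forall_inP h2].
have /orP[/eqP->//|r21] := implyP (h1 _ S2) r2.
have /orP[/eqP->//|r12] := implyP (h2 _ S1) r1.
by have := asym _ _ r12; rewrite r21.
Qed.

Lemma adjacent_sub (r : rel 'I_N) (S S' : {set 'I_N}) p p' :
  S' \subset S -> p' \in S' -> adjacent r S p p' -> adjacent r S' p p'.
Proof.
move=> /subsetP sS S'p /and3P[_ rp /forall_inP h]; rewrite /adjacent S'p rp /=.
by apply/forall_inP=> z /sS /h.
Qed.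

(* A neighbour that dies was not dense on its tenure, so it was covered in less
   than a quarter of the steps of that tenure. *)
Lemma sum_next_to_covered (r : rel 'I_N) p n :
  (forall x y, r x y -> ~~ r y x) -> alive n = set0 ->
  4 * \sum_(j < n) next_to_covered r (alive j) j p <= n.-1.
Proof.
move=> asym dead; set B := fun n => \sum_(j < n) next_to_covered r (alive j) j p.
have BS h : B h.+1 = B h + next_to_covered r (alive h) h p by rewrite /B big_ord_recr.
(* A running tenure began at step [g], where the bound held; the steps counted since then are
   charged to hits of [p']. *)
pose tenure h := exists p' g, [/\ adjacent r (alive h) p p', g <= h, 4 * B g <= g.-1
                                & B h + hits p' g <= B g + hits p' h].
have step h : tenure h -> 4 * B h.+1 <= h \/ tenure h.+1.
  move=> [p' [g [adj gh Bg Bh]]].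
  have Bcov : next_to_covered r (alive h) h p <= covered h p'.
    case nc: (next_to_covered _ _ _ _) => //.
    by case/existsP: nc => p2 /andP[adj2 c2]; rewrite (adjacent_inj asym adj adj2) c2.
  have {}Bh : B h.+1 + hits p' g <= B g + hits p' h.+1 by rewrite BS hitsS; lia.
  have [p'h|p'h] := boolP (p' \in alive h.+1).
    right; exists p', g; split=> //; last exact: leqW.
    exact: adjacent_sub (alive_sub (leqnSn h)) p'h adj.
  left; move: p'h; rewrite /= inE; case/and3P: adj => -> _ _ /=.
  rewrite !negb_or => /andP[/existsPn nd _].
  have gh1 : g < h.+1 by [].
  have := nd (Ordinal gh1); rewrite -ltnNge /=.
  have := @leq_hits p' g h.+1 (leqW gh); lia.
suff: 4 * B n <= n.-1 \/ tenure n.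
  by case=> // -[p' [g [/and3P[+ _ _] _ _ _]]]; rewrite dead inE.
elim: n {dead} => [|h IH]; first by left; rewrite /B big_ord0.
case: IH => [Bh|/step//].
case: (boolP (next_to_covered r (alive h) h p)) => [|hn]; last first.
  by left; rewrite BS (negbTE hn) addn0 /=; apply: leq_trans Bh (leq_pred h).
by case/existsP=> p' /andP[adj _]; apply: step; exists p', h; split.
Qed.

Hypothesis sdisj : forall i j, i < j < size s -> [disjoint nth set0 s i & nth set0 s j].

Lemma sum_classes v n : \sum_(j < n) (v \in nth set0 s j) <= 1.
Proof.
case: (boolP [exists j : 'I_n, v \in nth set0 s j]) => [/existsP[j0 vj0]|/existsPn h].
  rewrite (bigD1 j0) //= vj0 big1 // => j jj0; apply/eqP; rewrite eqb0; apply/negP=> vj.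
  have sz i : v \in nth set0 s i -> i < size s.
    by move=> vi; rewrite ltnNge; apply/negP=> le; move: vi; rewrite nth_default ?inE.
  have neq : (j : nat) != j0 by [].
  have dj i1 i2 : i1 < i2 -> v \in nth set0 s i1 -> v \in nth set0 s i2 -> False.
    move=> lt v1 v2; have := @sdisj i1 i2; rewrite lt sz // => /(_ isT) /disjointFr.
    by move=> /(_ _ v1); rewrite v2.
  by move: neq; rewrite neq_ltn => /orP[/dj|/dj]; apply.
by rewrite big1 // => j _; rewrite (negbTE (h j)).
Qed.

(** Disjoint classes covering [p] do so with different elements of [bag p]. *)
Lemma hits_bag p n : hits p n <= #|bag p|.
Proof.
have cov_le j : covered j p <= \sum_(v in bag p) (v \in nth set0 s j).
  rewrite /covered; case: set0Pn => //= -[v /setIP[vj vp]].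
  by rewrite (bigD1 v) //= vj.
apply: leq_trans (leq_sum _ (fun (j : 'I_n) _ => cov_le j)) _.
rewrite exchange_big /= -sum1_card; apply: leq_sum => v _; exact: sum_classes.
Qed.

(** From step [size s] on nothing is covered, so in the end only density could keep a point, and
    hits are then too few for any window. *)
Lemma alive_vanishes : exists n, alive n == set0.
Proof.
exists (4 * size s).+1; rewrite -subset0; apply/subsetP=> p.
have nocov j q : size s <= j -> covered j q = false.
  by move=> le; rewrite /covered nth_default // set0I eqxx.
have hitsD q g n : g <= n -> hits q n <= hits q g + (size s - g).
  move=> /subnK <-; elim: (n - g) => [|i IH]; first by rewrite leq_addr.
  rewrite addSn hitsS; case: (leqP (size s) (i + g)) => [le|lt]; last first.
    have: hits q (i + g) <= hits q g + i.
      elim: i {IH lt} => [|i IH]; first by rewrite addn0.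
      by rewrite addSn hitsS; case: (covered _ _); lia.
    by case: (covered _ _); lia.
  by rewrite nocov //; lia.
rewrite /= inE => /andP[_]; case/or3P => [/existsP[g]||].
- have := hitsD p g _ (ltnW (ltn_ord g)); have := ltn_ord g; lia.
- by case/existsP=> p' /andP[_]; rewrite nocov //; lia.
- by case/existsP=> p' /andP[_]; rewrite nocov //; lia.
Qed.

(** * Survival of live points under later classes *)

Variable e : rel V.
Hypothesis bag_convex : forall v (p q z : 'I_N),
  v \in bag p -> v \in bag q -> p <= z <= q -> v \in bag z.
Hypothesis bag_nonempty : forall v, exists p, v \in bag p.
Hypothesis bag_edge : forall u v, e u v -> exists2 p, u \in bag p & v \in bag p.
Hypothesis sn0 : forall C, C \in s -> C != set0.
Hypothesis sff : forall i j, i < j < size s -> forall v, v \in nth set0 s j ->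
  exists2 u, u \in nth set0 s i & e u v.

Lemma covered_dense h p : covered h p -> dense p h.+1.
Proof.
move=> c; apply/existsP; exists ord_max; rewrite /= hitsS c; lia.
Qed.

(** Take live points [p] under [u] and [q] under [v] as close as possible. The two intervals share
    [t], so every point between is under [u] or [v] and cannot be live; thus [q] has the covered
    neighbour [p] or equals it. *)
Lemma alive_class h j v : h <= j < size s -> v \in nth set0 s j ->
  exists2 p, p \in alive h & v \in bag p.
Proof.
elim: h j v => [|h IH] j v.
  by move=> _ _; have [p vp] := bag_nonempty v; exists p; rewrite ?inE.
move=> /andP[hj js] vj.
have hjs : h < j < size s by rewrite hj js.
have [u uh euv] := sff hjs vj.
have hs : h <= h < size s by rewrite leqnn (ltn_trans hj js).
have [pu Su upu] := IH _ _ hs uh.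
have hjs' : h <= j < size s by rewrite ltnW.
have [pv Sv vpv] := IH _ _ hjs' vj.
have [t ut vt] := bag_edge euv.
pose close (c : 'I_N * 'I_N) :=
  [&& c.1 \in alive h, u \in bag c.1, c.2 \in alive h & v \in bag c.2].
have close0 : close (pu, pv) by rewrite /close /= Su upu Sv vpv.
case: (arg_minnP (fun c : 'I_N * 'I_N => (c.1 - c.2) + (c.2 - c.1)) close0).
case=> p q /and4P[/= Sp up Sq vq] hmin.
have covp : covered h p by apply/set0Pn; exists u; rewrite inE uh.
exists q => //=; rewrite inE Sq /=.
case: (ltngtP p q) => [lt|gt|/val_inj E]; last by rewrite -E covered_dense.
- apply/or3P; apply: Or32; apply/existsP; exists p; rewrite covp andbT /adjacent Sp.
  rewrite /ltp lt /=; apply/forall_inP=> z Sz; apply/implyP=> zq.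
  case: (ltngtP z p) => [|pz|/val_inj->]; rewrite ?eqxx ?orbT //.
  have [zt|tz] := leqP z t.
    have uz : u \in bag z by apply: bag_convex up ut _; rewrite ltnW.
    by have := hmin (z, q); rewrite /close /= Sz uz Sq vq => /(_ isT) /= le; clear - le pz zq; lia.
  have vz : v \in bag z by apply: bag_convex vt vq _; rewrite (ltnW tz) ltnW.
  by have := hmin (p, z); rewrite /close /= Sz vz Sp up => /(_ isT) /= le; clear - le pz zq; lia.
- apply/or3P; apply: Or33; apply/existsP; exists p; rewrite covp andbT /adjacent Sp.
  rewrite /gtp gt /=; apply/forall_inP=> z Sz; apply/implyP=> zq.
  case: (ltngtP z p) => [pz||/val_inj->]; rewrite ?eqxx ?orbT //.
  have [zt|tz] := leqP z t.
    have vz : v \in bag z by apply: bag_convex vq vt _; rewrite zt ltnW.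
    by have := hmin (p, z); rewrite /close /= Sz vz Sp up => /(_ isT) /= le; clear - le pz zq; lia.
  have uz : u \in bag z by apply: bag_convex ut up _; rewrite (ltnW tz) ltnW.
  by have := hmin (z, q); rewrite /close /= Sz uz Sq vq => /(_ isT) /= le; clear - le pz zq; lia.
Qed.

Lemma alive_size : 0 < size s -> alive (size s) != set0.
Proof.
case E: (size s) => [//|h] _.
have hs : h < size s by rewrite E.
have /set0Pn[v vh] := sn0 (mem_nth set0 hs).
have hhs : h <= h < size s by rewrite leqnn.
have [p Sp vp] := alive_class hhs vh.
apply/set0Pn; exists p; rewrite /= inE Sp covered_dense //.
by apply/set0Pn; exists v; rewrite inE vh.
Qed.

Lemma first_fit_interval w : (forall p, #|bag p| <= w) -> size s <= 8 * w.
Proof.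
move=> bagw; case: (posnP (size s)) => [->//|s0].
case: (ex_minnP alive_vanishes) => n /eqP dead nmin.
have sn : size s < n.
  rewrite ltnNge; apply/negP=> /alive_sub; rewrite dead subset0.
  exact/negP/alive_size.
case: n sn dead nmin => // h sh dead nmin.
have /set0Pn[p Sp] : alive h != set0.
  by apply/negP=> /nmin; rewrite ltnn.
have asl x y : ltp x y -> ~~ ltp y x by rewrite /ltp; lia.
have asg x y : gtp x y -> ~~ gtp y x by rewrite /gtp; lia.
have := sum_next_to_covered p asl dead; have := sum_next_to_covered p asg dead.
have := sum_dense p h; have := hits_bag p h; have := bagw p.
(* Each step before [h] kept [p] for one of three reasons, so [h <= 4 * w + h / 4 + h / 4]. *)
suff: h <= \sum_(j < h) dense p j.+1 + \sum_(j < h) next_to_covered ltp (alive j) j p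
           + \sum_(j < h) next_to_covered gtp (alive j) j p.
  rewrite !(big_ord_recr h) /=; lia.
rewrite -!big_split /= -[X in X <= _]card_ord -sum1_card; apply: leq_sum => j _.
have: p \in alive j.+1 by apply: (subsetP (alive_sub _)) Sp.
by rewrite /= inE => /andP[_]; case: (dense _ _); do 2 case: (next_to_covered _ _ _ _).
Qed.

End FirstFitInterval.

(** * The interval order inside the poset *)

Section Poset.

Variables (d : Order.disp_t) (T : finPOrderType d).

Definition climb (n : nat) (x y : T) : bool :=
  [exists p : n.-tuple T, path <%O x p && (last x p == y)].

Lemma climbP n x y :
  reflect (exists p, [/\ size p = n, path <%O x p & last x p = y]) (climb n x y).
Proof.
apply: (iffP existsP) => [[p /andP[pp /eqP]]|[p [/eqP sp pp lp]]].
  by exists p; rewrite size_tuple.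
by exists (Tuple sp); rewrite /= pp lp eqxx.
Qed.

Lemma path_bounds (x : T) p z : path <%O x p -> z \in x :: p -> x <= z <= last x p.
Proof.
elim: p x z => [|y p IH] x z /=; first by move=> _; rewrite inE => /eqP->; rewrite lexx.
move=> /andP[xy pp]; rewrite inE => /orP[/eqP->|zp].
  have /andP[_ yl] := IH _ _ pp (mem_head y p).
  by rewrite lexx (le_trans (ltW xy)).
by have /andP[yz ->] := IH _ _ pp zp; rewrite (le_trans (ltW xy)).
Qed.

Lemma climb_lt n x y : climb n.+1 x y -> x < y.
Proof.
case/climbP=> -[|z p] [//= _ /andP[xz pp] <-].
by have /andP[_] := path_bounds pp (mem_head z p); apply: lt_le_trans.
Qed.

Lemma climb_le n x y : climb n x y -> x <= y.
Proof.
case/climbP=> p [_ pp <-].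
by have /andP[_] := path_bounds pp (mem_head x p).
Qed.

Lemma path_is_chain (x : T) p : path <%O x p -> is_chain [set:: x :: p].
Proof.
move=> pp; apply/forall_inP=> y; rewrite inE => yp; apply/forall_inP=> z; rewrite inE => zp.
move: pp; rewrite -[path _ _ _]/(sorted <%O (x :: p)) lt_sorted_pairwise.
elim: (x :: p) y z yp zp => // a q IH y z; rewrite !inE /= => /orP[/eqP->|yq] /orP[/eqP->|zq];
  case/andP=> /allP aq pq; rewrite ?comparablexx //.
- by apply/orP; left; rewrite ltW ?aq.
- by apply/orP; right; rewrite ltW ?aq.
- exact: IH.
Qed.

Lemma path_card (x : T) p : path <%O x p -> #|[set:: x :: p]| = (size p).+1.
Proof.
move=> pp; rewrite -[RHS]/(size (x :: p)) -(card_uniqP _); first by apply: eq_card => z; rewrite inE.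
exact: (@lt_sorted_uniq _ _ (x :: p)).
Qed.

Lemma long_chains_comparable k (x x' : T) p p' :
  ~ contains_kk T k.+1 -> size p = k -> size p' = k -> path <%O x p -> path <%O x' p' ->
  exists z z', [/\ z \in x :: p, z' \in x' :: p' & z >=< z'].
Proof.
move=> kk sp sp' pp pp'.
case: (boolP (has (fun z => has (fun z' => z >=< z') (x' :: p')) (x :: p))).
  by case/hasP=> z zp /hasP[z' zp' c]; exists z, z'.
move=> /hasPn nc; case: kk; exists [set:: x :: p], [set:: x' :: p'].
have incomp a b : a \in x :: p -> b \in x' :: p' -> ~~ (a >=< b).
  by move=> /nc /hasPn h /h.
split; rewrite ?path_is_chain ?path_card ?sp ?sp' //.
- rewrite disjoint_subset; apply/subsetP=> z; rewrite !inE => zp; apply/negP=> zp'.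
  by have := incomp z z zp zp'; rewrite comparablexx.
- by move=> a b; rewrite !in_set; apply: incomp.
Qed.

Definition below (b : T) : {set T} := [set a | a < b].

Lemma below_lt_of_climb m x y b b' :
  ~ contains_kk T m.+2 -> climb m b y -> climb m.+1 x b' -> ~~ (x < y) ->
  (#|below b| < #|below b'|)%N.
Proof.
move=> kk /[dup] /climb_le bley /climbP[p [sp pp lp]].
move=> /[dup] /climb_lt xb' /climbP[p' [sp' pp' lp']] nxy; apply: proper_card.
rewrite properE; apply/andP; split; last first.
  apply/negP=> /subsetP/(_ x); rewrite !inE xb' => /(_ isT) xb.
  by rewrite (lt_le_trans xb bley) in nxy.
apply/subsetP=> a; rewrite !inE => ab.
(* The chains from [a] via [b] to [y] and from [x] to [b'] both have [m.+2] elements, so some two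
   members are comparable. *)
have pa : path <%O a (b :: p) by rewrite /= ab.
have sb : size (b :: p) = m.+1 by rewrite /= sp.
have [z [z' [zp zp' c]]] := long_chains_comparable kk sb sp' pa pp'.
have /andP[az] := path_bounds pa zp; rewrite /= lp => zy.
have /andP[xz'] := path_bounds pp' zp'; rewrite lp' => zb'.
case/orP: c => c; last first.
  have := le_trans (le_trans xz' c) zy; rewrite le_eqVlt (negbTE nxy) orbF => /eqP xy.
  by apply: lt_trans xb'; rewrite xy (lt_le_trans ab).
have := le_trans (le_trans az c) zb'; rewrite le_eqVlt => /orP[/eqP ab'|//].
by rewrite (lt_le_trans xb') // -ab' in nxy; rewrite (le_trans (ltW ab)).
Qed.

Lemma card_antichain (A : {set T}) : is_antichain A -> (#|A| <= width T)%N.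
Proof. exact: (@leq_bigmax_cond _ _ (fun A : {set T} => #|A|)). Qed.

(** Remove the antichain of minimal elements: a chain of [m.+1] elements in the rest would extend
    downwards within [S]. *)
Lemma mirsky m (S : {set T}) :
  (forall x p, path <%O x p -> {subset x :: p <= S} -> size p != m) ->
  (#|S| <= m * width T)%N.
Proof.
elim: m S => [|m IH] S nochain.
  rewrite leqn0 cards_eq0; apply/eqP/setP=> x; rewrite inE; apply/negP=> xS.
  suff: size (Nil T) != 0%N by [].
  by apply: (nochain x) => // y; rewrite inE => /eqP->.
pose M := [set x in S | [forall y in S, ~~ (y < x)]].
have MS : M \subset S by apply/subsetP=> x; rewrite inE => /andP[].
have anti : is_antichain M.
  apply/forall_inP=> x; rewrite inE => /andP[xS /forall_inP mx].
  apply/forall_inP=> y; rewrite inE => /andP[yS /forall_inP my].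
  apply/implyP=> xy; rewrite /Order.comparable !le_eqVlt [y == x]eq_sym (negbTE xy) /=.
  by rewrite negb_or my // mx.
rewrite -(setIidPr MS) setIC in anti.
rewrite -(cardsID M S) mulSn leq_add ?card_antichain // 1?setIC //.
apply: IH => x p pp sub; apply/negP=> sp.
have := sub x (mem_head _ _); rewrite !inE negb_and => /andP[/orP[/negP//|] nmin xS].
case/forall_inPn: nmin => y yS; rewrite negbK => yx.
have := nochain y (x :: p); rewrite /= yx pp eqSS sp => /(_ isT).
by move=> h; apply: notF; apply: h => z; rewrite inE => /orP[/eqP->//|/sub]; rewrite inE => /andP[].
Qed.

(* The elements whose interval in the interval order contains [t]; the left end
   of the interval of [x] is the largest [#|below b|] over the [b] from which one
   climbs [m] steps to [x], and its right end is the smallest [#|below b|] over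
   the [b] reached from [x] in [m.+1] steps. *)
Definition slab (m t : nat) : {set T} :=
  [set x | [forall b, climb m b x ==> (#|below b| <= t)%N] &&
           [forall b, climb m.+1 x b ==> (t < #|below b|)%N]].

Lemma slabP m t x :
  reflect ((forall b, climb m b x -> (#|below b| <= t)%N) /\
           (forall b, climb m.+1 x b -> (t < #|below b|)%N)) (x \in slab m t).
Proof.
rewrite inE; apply: (iffP andP) => -[h1 h2]; split.
- by move=> b; apply/implyP; move/forallP: h1.
- by move=> b; apply/implyP; move/forallP: h2.
- by apply/forallP=> b; apply/implyP; apply: h1.
- by apply/forallP=> b; apply/implyP; apply: h2.
Qed.

Lemma slab_convex m x p q z :
  x \in slab m p -> x \in slab m q -> (p <= z <= q)%N -> x \in slab m z.
Proof.
move=> /slabP[p1 _] /slabP[_ q2] /andP[pz zq]; apply/slabP; split=> b h.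
  exact: leq_trans (p1 _ h) pz.
exact: leq_ltn_trans zq (q2 _ h).
Qed.

(** Neither interval ends before the other starts, so the later left end lies in both. The case
    [u = v] shows that intervals are nonempty. *)
Lemma slab_incomparable m u v :
  ~ contains_kk T m.+2 -> ~~ (u < v) -> ~~ (v < u) ->
  exists2 t : 'I_#|T|.+1, u \in slab m t & v \in slab m t.
Proof.
move=> kk uv vu.
pose l y := (\max_(b | climb m b y) #|below b|)%N.
have tT : (maxn (l u) (l v) < #|T|.+1)%N.
  by rewrite ltnS geq_max; apply/andP; split; apply/bigmax_leqP=> b _; apply: max_card.
have l_lt x y b : ~~ (x < y) -> climb m.+1 x b -> (l y < #|below b|)%N.
  move=> xy xb; have b0 : (0 < #|below b|)%N.
    by apply/card_gt0P; exists x; rewrite inE (climb_lt xb).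
  rewrite -(prednK b0) ltnS; apply/bigmax_leqP=> c cy.
  by rewrite -ltnS prednK // (below_lt_of_climb kk cy xb).
have l_ge y b : climb m b y -> (#|below b| <= l y)%N.
  by move=> h; rewrite /l (bigD1 b) //= leq_maxl.
exists (Ordinal tT); apply/slabP; split=> b h /=.
- by rewrite leq_max (l_ge u).
- by rewrite gtn_max !(l_lt u) ?ltxx.
- by rewrite leq_max (l_ge v) ?orbT.
- by rewrite gtn_max !(l_lt v) ?ltxx.
Qed.

(** In a chain of [2 * m + 2] elements, the element [c] reached after [m.+1] steps would give
    [t < #|below c| <= t]. *)
Lemma card_slab m t : (#|slab m t| <= (2 * m).+1 * width T)%N.
Proof.
apply: mirsky => x p pp sub; apply/negP=> /eqP sp.
have szt : size (take m.+1 p) = m.+1 by rewrite size_takel // sp; lia.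
move: pp; rewrite -(cat_take_drop m.+1 p) cat_path => /andP[pt pd].
have /slabP[_ hx] := sub x (mem_head _ _).
have /slabP[hy _] := sub _ (mem_last x p).
have cx : climb m.+1 x (last x (take m.+1 p)) by apply/climbP; exists (take m.+1 p).
have cy : climb m (last x (take m.+1 p)) (last x p).
  apply/climbP; exists (drop m.+1 p); split=> //; first by rewrite size_drop sp; lia.
  by rewrite -last_cat cat_take_drop.
by have := leq_trans (hx _ cx) (hy _ cy); rewrite ltnn.
Qed.

End Poset.

Theorem theorem5 (d : Order.disp_t) (T : finPOrderType d) (k : nat) (s : seq {set T}) :
  (2 <= k)%N -> ~ contains_kk T k -> first_fit_partition s ->
  (size s <= 8 * (2 * k - 3) * width T)%N.
Proof.
case: k => [|[|m]] // _ kk [sn0 _ sdisj _ sff].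
rewrite -mulnA (_ : 2 * m.+2 - 3 = (2 * m).+1)%N; last by lia.
apply: (@first_fit_interval T #|T|.+1 (fun t => slab T m t) s sdisj (fun u v => ~~ (u >=< v))).
- by move=> v p q z; apply: slab_convex.
- by move=> v; have [t vt _] := slab_incomparable kk (negbT (ltxx v)) (negbT (ltxx v)); exists t.
- move=> u v; rewrite negb_or => /andP[uv vu].
  by apply: slab_incomparable => //; [apply: contra uv|apply: contra vu]; apply: ltW.
- exact: sn0.
- exact: sff.
- by move=> t; apply: card_slab.
Qed.
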